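(* Let $\beta_2>2$. The equation $$\log\left(\frac{\frac12+\delta}{\frac12-\delta}\right)-2\beta_2\delta=0$$ has a unique solution $\delta=\delta(\beta_2)$ in the interval $(0,\frac12)$, and the graphon $$h(x,y)=\begin{cases}\frac12+\delta(\beta_2)&\text{if }0<x,y<\frac12,\\ \frac12-\delta(\beta_2)&\text{if }\frac12<x,y<1,\\ \frac12&\text{otherwise}\end{cases}$$ is a stationary point of the two-star variational problem at edge density $\frac12$, that is, of the problem of maximizing $$\beta_2\int_0^1\left(\int_0^1h(x,y)\,dy\right)^2dx-\frac12\iint_{[0,1]^2}I(h(x,y))\,dx\,dy$$ over graphons $h$ with $\iint_{[0,1]^2}h(x,y)\,dx\,dy=\frac12$.
   Context: A graphon is a measurable function $h:[0,1]^2\to[0,1]$ with $h(x,y)=h(y,x)$. $I(x)=x\log x+(1-x)\log(1-x)$ on $[0,1]$, with $0\log 0=0$. A graphon $h$ (with values in $(0,1)$) is a stationary point of this constrained problem if $\iint_{[0,1]^2}h=\frac12$ and $h$ satisfies the Euler–Lagrange equation for some Lagrange multiplier $\beta_1\in\mathbb{R}$, namely $$2\beta_1-2\beta_2g(x)-2\beta_2g(y)=\log\left(\frac{1-h(x,y)}{h(x,y)}\right)\quad\text{for a.e. }(x,y)\in[0,1]^2,\qquad g(x)=\int_0^1h(x,y)\,dy.$$ *)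

(* Defs.v *)
From HB Require Import structures.
From mathcomp Require Import all_boot all_order all_algebra.
From mathcomp Require Import all_classical all_reals all_analysis.

Set Implicit Arguments.
Unset Strict Implicit.
Unset Printing Implicit Defensive.

Import Order.TTheory GRing.Theory Num.Theory.
Import numFieldNormedType.Exports.

Local Open Scope classical_set_scope.
Local Open Scope ring_scope.

Definition unit_interval (R : realType) : set R := `[0, 1].
Arguments unit_interval : clear implicits.

Definition unit_square (R : realType) : set (R * R) :=
  unit_interval R `*` unit_interval R.
Arguments unit_square : clear implicits.

(* [measurableTypeR R] is [R] with its Borel sigma-algebra, on which
   [lebesgue_measure] is defined; [plane R] is convertible to [R * R]. *)
Notation plane R := (measurableTypeR R * measurableTypeR R)%type.
Notation plane_measure R :=
  ((@lebesgue_measure R) \x (@lebesgue_measure R))%E.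

(* A graphon is a total function on the plane constrained only on the unit
   square; its values elsewhere are irrelevant. *)
Definition is_graphon (R : realType) (h : R * R -> R) : Prop :=
  [/\ measurable_fun (unit_square R : set (plane R)) h,
      (forall x y : R, unit_square R (x, y) -> 0 <= h (x, y) <= 1) &
      (forall x y : R, unit_square R (x, y) -> h (x, y) = h (y, x))].

Definition degree (R : realType) (h : R * R -> R) (x : R) : R :=
  \int[@lebesgue_measure R]_(y in unit_interval R) h (x, y).

Definition edge_density (R : realType) (h : R * R -> R) : R :=
  \int[plane_measure R]_(p in unit_square R) h p.

(* The Euler-Lagrange equation, with multiplier beta1, of the problem of
   maximizing
     beta2 * \int_x (degree h x)^2 - 1/2 * \int_(x, y) I (h (x, y)),
     I u = u ln u + (1 - u) ln (1 - u),
   over graphons h of prescribed edge density. *)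
Definition euler_lagrange (R : realType) (beta2 beta1 : R) (h : R * R -> R) :
    Prop :=
  {ae plane_measure R, forall p : R * R, unit_square R p ->
    2 * beta1 - 2 * beta2 * degree h p.1 - 2 * beta2 * degree h p.2 =
    ln ((1 - h p) / h p)}.

(* Stationary points of that problem at edge density e. The values are
   required to lie in ]0, 1[ so that the logarithm above is a genuine one. *)
Definition stationary_point (R : realType) (beta2 e : R) (h : R * R -> R) :
    Prop :=
  [/\ is_graphon h,
      (forall p : R * R, unit_square R p -> 0 < h p < 1),
      edge_density h = e &
      exists beta1 : R, euler_lagrange beta2 beta1 h].

Definition block_graphon (R : realType) (delta : R) (p : R * R) : R :=
  if (0 < p.1 < 1 / 2) && (0 < p.2 < 1 / 2) then 1 / 2 + delta
  else if (1 / 2 < p.1 < 1) && (1 / 2 < p.2 < 1) then 1 / 2 - delta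
  else 1 / 2.

(* Main.v *)
(* The gap d |-> ln ((1/2 + d) / (1/2 - d)) - 2 b d vanishes at 0 and has
   derivative 1 / (1/4 - d^2) - 2 b, which for b > 2 is negative and then
   positive on ]0, 1/2[; so the gap decreases below 0, then increases strictly
   and becomes positive, whence a unique positive root delta.  The degree of the
   block graphon is 1/2 + delta/2 on ]0, 1/2[ and 1/2 - delta/2 on ]1/2, 1[, so
   with multiplier beta1 = beta2 the Euler-Lagrange equation is the equation of
   delta on the two diagonal blocks and 0 = ln 1 on the two others.  It may fail
   on the lines where a coordinate is 0, 1/2 or 1, which are negligible. *)
Require Import Defs.
From mathcomp Require Import all_boot all_order all_algebra.
From mathcomp Require Import all_classical all_reals all_analysis.
From mathcomp Require Import measurable_realfun.
From mathcomp Require Import ring lra.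

Import Order.TTheory GRing.Theory Num.Theory.
Import numFieldNormedType.Exports.
Local Open Scope classical_set_scope.
Local Open Scope ring_scope.

(** * The gap function and its unique positive root *)

Definition logit_gap (R : realType) (b d : R) : R :=
  ln (1 / 2 + d) - ln (1 / 2 - d) - 2 * b * d.

Lemma logit_gapE (R : realType) (b d : R) : 0 < d < 1 / 2 ->
  ln ((1 / 2 + d) / (1 / 2 - d)) - 2 * b * d = logit_gap R b d.
Proof. by move=> d12; rewrite /logit_gap ln_div ?posrE//; lra. Qed.

Lemma logit_gap0 (R : realType) (b : R) : logit_gap R b 0 = 0.
Proof. by rewrite /logit_gap addr0 subr0 mulr0 !subrr. Qed.

(** The range extends below 0 so that continuity at the closed endpoint 0 follows from
    differentiability. *)
Lemma is_derive_logit_gap (R : realType) (b d : R) : - (1 / 2) < d < 1 / 2 ->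
  is_derive d 1 (logit_gap R b) ((1 / 4 - d ^+ 2)^-1 - 2 * b).
Proof.
move=> /andP[d1 d2].
have p1 : 0 < 1 / 2 + d by lra.
have p2 : 0 < 1 / 2 - d by lra.
have D1 : is_derive d 1 (@ln R \o (cst (1 / 2) + id)) (1 / 2 + d)^-1.
  rewrite -[X in is_derive _ _ _ X]mulr1.
  apply: is_derive1_comp; first exact: is_derive1_ln.
  by apply: is_derive_eq; rewrite add0r.
have D2 : is_derive d 1 (@ln R \o (cst (1 / 2) - id)) (- (1 / 2 - d)^-1).
  rewrite -[X in is_derive _ _ _ X]mulrN1.
  apply: is_derive1_comp; first exact: is_derive1_ln.
  by apply: is_derive_eq; rewrite add0r.
have D3 : is_derive d 1 (fun x : R => 2 * b * x) (2 * b).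
  by apply: is_derive_eq; rewrite scaler1.
rewrite [logit_gap R b](_ : _ = (@ln R \o (cst (1 / 2) + id)) -
  (@ln R \o (cst (1 / 2) - id)) - (fun x : R => 2 * b * x))//.
apply: (is_derive_eq (is_deriveB (is_deriveB D1 D2) D3)).
have -> : 1 / 4 - d ^+ 2 = (1 / 2 + d) * (1 / 2 - d) by field.
by field; apply/andP; split; rewrite gt_eqF//; lra.
Qed.

Lemma within_continuous_logit_gap (R : realType) (b l r : R) :
  - (1 / 2) < l -> r < 1 / 2 -> {within `[l, r], continuous (logit_gap R b)}.
Proof.
move=> hl hr; apply: continuous_in_subspaceT => x /set_mem/=; rewrite in_itv/=.
move=> /andP[lx xr]; apply: differentiable_continuous; apply/derivable1_diffP.
have := @is_derive_logit_gap R b x; rewrite (lt_le_trans hl)//=.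
by rewrite (le_lt_trans xr)// => /(_ isT) [].
Qed.

(** On [[0, 1/2[] the derivative of the gap increases with [x ^+ 2] and vanishes when
    [x ^+ 2 = 1 / 4 - (2 * b)^-1], which is positive exactly because [b > 2]. Thus [c] is the
    minimum point of the gap. *)
Lemma logit_gap_inflection (R : realType) (b : R) : 2 < b ->
  exists c : R,
  [/\ 0 < c < 1 / 2,
      (forall x, 0 <= x < c -> (1 / 4 - x ^+ 2)^-1 - 2 * b < 0) &
      (forall x, c < x < 1 / 2 -> 0 < (1 / 4 - x ^+ 2)^-1 - 2 * b)].
Proof.
move=> b2; have b0 : 0 < b by lra.
(* t is the square of the zero of the derivative *)
set t : R := 1 / 4 - (2 * b)^-1.
have t0 : 0 < t.
  by rewrite subr_gt0 -div1r ltr_pdivrMr; lra.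
have bV0 : 0 < (2 * b)^-1 by rewrite invr_gt0; lra.
exists (Num.sqrt t).
have s0 : 0 < Num.sqrt t by rewrite sqrtr_gt0.
have ss : Num.sqrt t ^+ 2 = t by rewrite sqr_sqrtr ?ltW.
have tE : 1 / 4 - t = (2 * b)^-1 by rewrite /t; ring.
split.
- rewrite s0/= -(@ltr_pXn2r _ 2%N) ?nnegrE ?(ltW s0)//.
  by rewrite ss /t; lra.
- move=> x /andP[x0 xc].
  have x2 : x ^+ 2 < t by rewrite -ss ltr_pXn2r ?nnegrE ?(ltW s0).
  rewrite subr_lt0 -[ltRHS]invrK ltf_pV2 ?posrE//; lra.
- move=> x /andP[xc x12].
  have x0 : 0 < x by lra.
  have x2 : t < x ^+ 2 by rewrite -ss ltr_pXn2r ?nnegrE ?(ltW s0)// ltW.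
  have x4 : x ^+ 2 < 1 / 4.
    have -> : 1 / 4 = (1 / 2) ^+ 2 :> R by field.
    by rewrite ltr_pXn2r ?nnegrE ?(ltW x0)//; lra.
  rewrite subr_gt0 -[ltLHS]invrK ltf_pV2 ?posrE//; lra.
Qed.

Lemma logit_gap_pos (R : realType) (b : R) : 0 < b ->
  exists2 r : R, 0 < r < 1 / 2 & 0 < logit_gap R b r.
Proof.
move=> b0; (* At r = (1 - e) / 2 the logit is ln ((2 - e) / e) > ln (1 / e) = b. *)
set e := expR (- b).
have e0 : 0 < e by exact: expR_gt0.
have e1 : e < 1 by rewrite expR_lt1; lra.
exists (1 / 2 * (1 - e)); first lra.
rewrite -logit_gapE; last lra.
have be : - b = ln e by rewrite expRK.
have : b < ln ((1 / 2 + 1 / 2 * (1 - e)) / (1 / 2 - 1 / 2 * (1 - e))).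
  have -> : b = ln e^-1 by rewrite lnV ?posrE// -be opprK.
  have -> : 1 / 2 - 1 / 2 * (1 - e) = e / 2 by field.
  rewrite ltr_ln ?posrE ?invr_gt0//; last by rewrite divr_gt0//; lra.
  rewrite ltr_pdivlMr; last lra.
  by rewrite mulrA mulVf ?gt_eqF//; lra.
(* The linear term at this point is [b * (1 - e) = b - b * e], below [b] and hence below the
   logit. *)
have : 0 < b * e by rewrite mulr_gt0.
lra.
Qed.

Lemma logit_gap_unique_root (R : realType) (b : R) : 2 < b ->
  exists delta : R,
    unique (fun d : R => 0 < d < 1 / 2 /\ logit_gap R b d = 0) delta.
Proof.
move=> b2; have [c [/andP[c0 c12] fdec finc]] := @logit_gap_inflection R b b2.
have dec x : 0 < x <= c -> logit_gap R b x < 0.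
  move=> /andP[x0 xc]; rewrite -(@logit_gap0 R b).
  apply: (@ltr0_derive1_lt_cc _ _ 0 c); rewrite ?in_itv/= ?lexx ?xc ?ltW//.
  - move=> y; rewrite in_itv/= => y0.
    by have [|] := @is_derive_logit_gap R b y; first lra.
  - move=> y; rewrite in_itv/= => y0; rewrite derive1E.
    have [|_ ->] := @is_derive_logit_gap R b y; first lra.
    by apply: fdec; lra.
  - by apply: within_continuous_logit_gap; lra.
have inc x y : c < x -> x < y -> y < 1 / 2 -> logit_gap R b x < logit_gap R b y.
  move=> cx xy y12.
  apply: (@gtr0_derive1_lt_cc _ _ c y); rewrite ?in_itv/= ?lexx ?ltW//.
  - move=> z; rewrite in_itv/= => yz.
    by have [|] := @is_derive_logit_gap R b z; first lra.
  - move=> z; rewrite in_itv/= => yz; rewrite derive1E.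
    have [|_ ->] := @is_derive_logit_gap R b z; first lra.
    by apply: finc; lra.
  - by apply: within_continuous_logit_gap; lra.
  - exact: lt_trans xy.
(* Every positive root is thereby confined to the region where the gap is injective. *)
have root_gt x : 0 < x -> logit_gap R b x = 0 -> c < x.
  move=> x0 fx; rewrite ltNge; apply/negP => xc.
  by have := dec x; rewrite fx ltxx x0 xc => /(_ isT).
have [|r /andP[r0 r12] fr] := @logit_gap_pos R b; first lra.
(* The gap is negative up to [c], so [r] lies beyond it and [[c, r]] carries a sign change. *)
have cr : c < r.
  rewrite ltNge; apply/negP => rc.
  by have := dec r; rewrite r0 rc => /(_ isT); rewrite ltNge ltW.
have fc : logit_gap R b c < 0 by apply: dec; rewrite c0 lexx.
have [||d] := @IVT _ (logit_gap R b) c r 0 (ltW cr).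
- by apply: within_continuous_logit_gap; lra.
- by rewrite ge_min le_max (ltW fc) (ltW fr) orbT.
rewrite in_itv/= => /andP[cd dr] fd.
have d0 : 0 < d by lra.
exists d; split; first by split=> //; lra.
move=> d' [/andP[d'0 d'12] fd'].
have cd1 := root_gt _ d0 fd; have cd2 := root_gt _ d'0 fd'.
case: (ltgtP d d') => // dd'.
- by have := inc _ _ cd1 dd' d'12; rewrite fd fd' ltxx.
- by have := inc _ _ cd2 dd'; rewrite fd fd' ltxx => /(_ ltac:(lra)).
Qed.

(** * Degree and edge density of the block graphon *)

(** Stated for an arbitrary measure so as to serve both the degree, on the interval, and the edge
    density, on the square. Finiteness of [mu D] makes the bounded terms integrable, and linearity
    concludes. *)
Lemma Rintegral_indic2 d (T : measurableType d) (R : realType)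
    (mu : {measure set T -> \bar R}) (D A B : set T) (k a b : R) :
  measurable D -> measurable A -> measurable B -> (mu D < +oo)%E ->
  A `<=` D -> B `<=` D ->
  \int[mu]_(x in D) (k + a * \1_A x - b * \1_B x) =
  k * fine (mu D) + a * fine (mu A) - b * fine (mu B).
Proof.
move=> mD mA mB Dfin AD BD.
have ik : mu.-integrable D (EFin \o cst k).
  by apply: measurable_bounded_integrable => //; exact: bounded_cst.
have i1 E : measurable E -> mu.-integrable D (EFin \o \1_E).
  move=> mE; apply: measurable_bounded_integrable => //.
  exists 1; split => // M M1 x _ /=.
  by rewrite (le_trans _ (ltW M1))// indicE; case: (_ \in _); rewrite ?normr1 ?normr0.
have iZ c E : measurable E -> mu.-integrable D (EFin \o (fun x => c * \1_E x)).
  move=> mE; apply: (eq_integrable mD (fun x => c%:E * (EFin \o \1_E) x)%E) => //.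
  by apply: integrableZl => //; exact: i1.
have E1 E : measurable E -> E `<=` D -> \int[mu]_(x in D) \1_E x = fine (mu E).
  by move=> mE ED; rewrite /Rintegral integral_indic// (setIidl ED).
rewrite RintegralB//; [|exact: (integrableD mD ik (iZ _ _ mA))|exact: iZ].
rewrite RintegralD ?RintegralZl ?Rintegral_cst ?E1//.
- exact: i1.
- exact: i1.
- exact: iZ.
Qed.

Definition low (R : realType) : set R := `]0, (1 / 2)[.
Definition high (R : realType) : set R := `](1 / 2), 1[.

(** The two diagonal blocks are disjoint, so the nested conditional is a linear combination of
    indicators. *)
Lemma block_graphonE (R : realType) (delta : R) (p : R * R) :
  block_graphon delta p =
  1 / 2 + delta * \1_(low R `*` low R) p - delta * \1_(high R `*` high R) p.
Proof.
rewrite /block_graphon !indicE.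
have -> : (p \in low R `*` low R) = (0 < p.1 < 1 / 2) && (0 < p.2 < 1 / 2).
  by apply/idP/andP => [/set_mem[]|[h1 h2]]; [|apply/mem_set; split];
    rewrite /low/= ?in_itv.
have -> : (p \in high R `*` high R) = (1 / 2 < p.1 < 1) && (1 / 2 < p.2 < 1).
  by apply/idP/andP => [/set_mem[]|[h1 h2]]; [|apply/mem_set; split];
    rewrite /high/= ?in_itv.
case: ifPn => [/andP[h1 h2]|_]; last by case: ifPn => _ /=; ring.
by case: andP => [[]|_] /=; [lra|ring].
Qed.

Lemma low_high_measures (R : realType) :
  [/\ lebesgue_measure (unit_interval R) = 1%E,
      lebesgue_measure (low R) = (1 / 2)%:E &
      lebesgue_measure (high R) = (1 / 2)%:E].
Proof.
split; rewrite lebesgue_measure_itv/= lte_fin.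
- by rewrite ltr01 oppr0 adde0.
- by rewrite ifT ?oppr0 ?adde0//; lra.
- by rewrite ifT -?EFinB; [congr EFin; field|lra].
Qed.

Lemma measurable_unit_interval (R : realType) :
  measurable (unit_interval R : set (measurableTypeR R)).
Proof. by rewrite /unit_interval; exact: measurable_itv. Qed.

Lemma measurable_low (R : realType) :
  measurable (low R : set (measurableTypeR R)).
Proof. by rewrite /low; exact: measurable_itv. Qed.

Lemma measurable_high (R : realType) :
  measurable (high R : set (measurableTypeR R)).
Proof. by rewrite /high; exact: measurable_itv. Qed.

Lemma low_sub (R : realType) : low R `<=` unit_interval R.
Proof. by move=> x; rewrite /low /unit_interval/= !in_itv/=; lra. Qed.

Lemma high_sub (R : realType) : high R `<=` unit_interval R.
Proof. by move=> x; rewrite /high /unit_interval/= !in_itv/=; lra. Qed.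

Lemma degree_block_graphon (R : realType) (delta x : R) :
  degree (block_graphon delta) x =
  1 / 2 + delta / 2 * \1_(low R) x - delta / 2 * \1_(high R) x.
Proof.
have [mu1 muA muB] := low_high_measures R.
rewrite /degree.
(* The indicator of a square factors, and the factors in [x] become constant coefficients. *)
have sectE y : block_graphon delta (x, y) = 1 / 2 +
    delta * \1_(low R) x * \1_(low R) y - delta * \1_(high R) x * \1_(high R) y.
  by rewrite block_graphonE !indicE !in_setX/= -!mulnb !natrM !mulrA.
under eq_Rintegral do rewrite sectE.
rewrite (@Rintegral_indic2 _ _ _ lebesgue_measure).
- by rewrite /= muA muB mu1/=; field.
- exact: measurable_unit_interval.
- exact: measurable_low.
- exact: measurable_high.
- by rewrite /= mu1 ltry.
- exact: low_sub.
- exact: high_sub.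
Qed.

(** The two diagonal blocks have equal area, so their contributions cancel for every [delta]. *)
Lemma edge_density_block_graphon (R : realType) (delta : R) :
  edge_density (block_graphon delta) = 1 / 2.
Proof.
have [mu1 muA muB] := low_high_measures R.
rewrite /edge_density /unit_square.
under eq_Rintegral do rewrite block_graphonE.
have mI := @measurable_unit_interval R.
have mA := @measurable_low R.
have mB := @measurable_high R.
rewrite Rintegral_indic2.
- by rewrite /= !product_measure1E//= muA muB mu1/=; field.
- exact: measurableX.
- exact: measurableX.
- exact: measurableX.
- by rewrite /= product_measure1E//= mu1 mul1e ltry.
- by move=> p [/low_sub ? /low_sub ?]; split.
- by move=> p [/high_sub ? /high_sub ?]; split.
Qed.

Lemma block_graphon_is_graphon (R : realType) (delta : R) : 0 < delta < 1 / 2 ->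
  is_graphon (block_graphon delta).
Proof.
move=> d01; split.
- have -> : block_graphon delta = fun p : plane R => 1 / 2 +
      delta * \1_(low R `*` low R) p - delta * \1_(high R `*` high R) p.
    by apply/funext => p; exact: block_graphonE.
  apply: measurable_funB; first apply: measurable_funD => //.
  + apply: measurable_funM => //; apply: measurable_indic.
    by apply: measurableX; exact: measurable_low.
  + apply: measurable_funM => //; apply: measurable_indic.
    by apply: measurableX; exact: measurable_high.
- by move=> x y _; rewrite /block_graphon; do 2?case: ifPn => _; lra.
- by move=> x y _; rewrite /block_graphon/= andbC [in X in if _ then _ else X]andbC.
Qed.

(** * The Euler-Lagrange equation *)

Lemma euler_lagrange_block_graphon (R : realType) (beta2 delta : R) :
  0 < delta < 1 / 2 -> logit_gap R beta2 delta = 0 ->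
  euler_lagrange beta2 beta2 (block_graphon delta).
Proof.
move=> d01; rewrite -logit_gapE// => /eqP; rewrite subr_eq0 => /eqP root.
(* These are the points of the unit interval that lie in neither open half. *)
pose Z : set (measurableTypeR R) := [set 0; 1 / 2; 1].
have mZ : measurable Z by do 2?apply: measurableU; exact: measurable_set1.
have Z0 : lebesgue_measure Z = 0%E.
  by apply: countable_lebesgue_measure0; apply: finite_set_countable; exact: finite_set3.
(* Each family of lines has measure a product of 0 and [+oo], which is 0 by convention. *)
have null : (plane_measure R).-negligible (Z `*` setT `|` setT `*` Z).
  apply: negligibleU.
  - exists (Z `*` setT); split => //; first exact: measurableX.
    by rewrite /= product_measure1E//= Z0 mul0e.
  - exists (setT `*` Z); split => //; first exact: measurableX.
    by rewrite /= product_measure1E//= Z0 mule0.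
have dich z : unit_interval R z -> ~ Z z ->
    (z \in low R) && (z \notin high R) || (z \notin low R) && (z \in high R).
  rewrite /unit_interval/= in_itv/= => /andP[z0 z1] nz.
  have z0' : 0 < z by rewrite lt_neqAle z0 andbT; apply/eqP => z0'; apply: nz; left; left.
  have z1' : z < 1 by rewrite lt_neqAle z1 andbT; apply/eqP => z1'; apply: nz; right.
  have z12 : z != 1 / 2 by apply/eqP => z12; apply: nz; left; right.
  have -> : (z \in low R) = (z < 1 / 2).
    by apply/idP/idP => [/set_mem|h]; [|apply/mem_set];
      rewrite /low/= in_itv/= ?z0'// => /andP[].
  have -> : (z \in high R) = (1 / 2 < z).
    by apply/idP/idP => [/set_mem|h]; [|apply/mem_set];
      rewrite /high/= in_itv/= ?z1' ?andbT// => /andP[].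
  by case: ltgtP z12.
(* By contraposition, it suffices to verify the equation at points off these lines. *)
apply: negligibleS null => -[x y]; apply: contra_notP => nZ.
move=> [/= Ix Iy].
have nZx : ~ Z x by move=> Zx; apply: nZ; left.
have nZy : ~ Z y by move=> Zy; apply: nZ; right.
rewrite !degree_block_graphon block_graphonE !indicE !in_setX/=.
(* On the low block [(1 - h) / h] is the inverse of the quotient in [root]; on the high block it is
   that quotient itself. *)
have lnE : ln ((1 / 2 - delta) / (1 / 2 + delta)) = - (2 * beta2 * delta).
  by rewrite -root -lnV ?posrE ?divr_gt0 ?invf_div//; lra.
(* The four blocks come in the order low-low, low-high, high-low, high-high. The two degrees sum to
   [1 + delta], 1, 1 and [1 - delta] respectively. *)
have /orP[/andP[-> /negbTE->]|/andP[/negbTE-> ->]] := dich x Ix nZx;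
have /orP[/andP[-> /negbTE->]|/andP[/negbTE-> ->]] := dich y Iy nZy;
  rewrite /= ?mulr1 ?mulr0 ?addr0 ?subr0.
- have -> : 1 - (1 / 2 + delta) = 1 / 2 - delta by field.
  by rewrite lnE; field.
- have -> : (1 - 1 / 2) / (1 / 2) = 1 :> R by field.
  by rewrite ln1; field.
- have -> : (1 - 1 / 2) / (1 / 2) = 1 :> R by field.
  by rewrite ln1; field.
- have -> : 1 - (1 / 2 - delta) = 1 / 2 + delta by field.
  by rewrite root; field.
Qed.

Theorem proposition21 (R : realType) (beta2 : R) (hbeta2 : 2 < beta2) :
  exists delta : R,
    unique (fun d : R => 0 < d < 1 / 2 /\
              ln ((1 / 2 + d) / (1 / 2 - d)) - 2 * beta2 * d = 0) delta /\
    stationary_point beta2 (1 / 2) (block_graphon delta).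
Proof.
have [d [[d01 fd] dU]] := @logit_gap_unique_root R beta2 hbeta2.
exists d; split.
  split; first by rewrite logit_gapE.
  by move=> d' [d'01]; rewrite logit_gapE// => fd'; exact: dU.
split.
- exact: block_graphon_is_graphon.
- by move=> p _; rewrite /block_graphon; do 2?case: ifPn => _; lra.
- exact: edge_density_block_graphon.
- by exists beta2; exact: euler_lagrange_block_graphon.
Qed.
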